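(* For any $\beta\ge 1$, any composable core-set of size at most $k^\beta$ for the $k$-determinant maximization problem must incur an approximation factor of at least $\left(\frac{k}{\beta}\right)^{k(1-o(1))}$, where $o(1)\to0$ as $k\to\infty$ (with $\beta$ constant). That is: for every constant $\beta\ge1$ there is a function $\delta(k)\to0$ as $k\to\infty$ such that for all $d\ge k$, if a function $c(\cdot)$ is an $\alpha$-composable core-set of size at most $k^\beta$ for the $k$-determinant maximization objective on $\mathbb{R}^d$, then $\alpha\ge\left(\frac{k}{\beta}\right)^{k(1-\delta(k))}$.
   Context: For $A\in\mathbb{R}^{d\times d}$, $\det_k(A)=\sum_{S\in\binom{[d]}{k}}\det A_{S,S}$. The $k$-determinant maximization objective of a finite set $V\subset\mathbb{R}^d$ is $f_k(V)=\max_{S\subseteq V,\,|S|=k}\det_k\big(\sum_{v\in S}vv^\intercal\big)$, with $f_k(V)=0$ if $|V|<k$. A function $c(\cdot)$ mapping each finite $V\subset\mathbb{R}^d$ to a subset of $V$ is an $\alpha$-composable core-set of size $t$ for $f_k$ if $|c(V)|\le t$ for all $V$ and $f_k(c(V_1)\cup\dots\cup c(V_p))\ge\frac1\alpha f_k(V_1\cup\dots\cup V_p)$ for every finite collection of finite sets $V_1,\dots,V_p\subset\mathbb{R}^d$. *)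

(* Defs.v *)
From HB Require Import structures.
From mathcomp Require Import all_boot all_order all_algebra finmap.
From mathcomp Require Import all_classical all_reals all_analysis.
Set Implicit Arguments.
Unset Strict Implicit.
Unset Printing Implicit Defensive.
Import Order.TTheory GRing.Theory Num.Theory.
Import numFieldNormedType.Exports.

Local Open Scope ring_scope.

Definition principal_submx (R : pzRingType) (d : nat) (A : 'M[R]_d)
    (S : {set 'I_d}) : 'M[R]_#|S| :=
  mxsub (@enum_val _ (mem S)) (@enum_val _ (mem S)) A.

Definition kdet (R : comPzRingType) (d k : nat) (A : 'M[R]_d) : R :=
  \sum_(S : {set 'I_d} | #|S| == k) \det (principal_submx A S).

Definition scatter (R : realType) (d : nat) (S : {fset 'cV[R]_d}) : 'M[R]_d :=
  \sum_(v <- enum_fset S) v *m v^T.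

(* The default 0 of the maximum gives the value 0 when V has fewer than k
   elements; otherwise it has no effect, as kdet k (scatter S) is a sum of
   principal minors of a positive semidefinite matrix, hence nonnegative. *)
Definition kdet_max (R : realType) (d k : nat) (V : {fset 'cV[R]_d}) : R :=
  \big[Num.max/0]_(S <- enum_fset (fpowerset V) | #|` S| == k)
    kdet k (scatter S).

(* The size bound t is real because it is instantiated with k `^ beta. The
   condition 0 < alpha is implicit in the factor 1 / alpha; without it,
   alpha <= 0 would satisfy the last clause vacuously (0^-1 = 0 here). *)
Definition composable_coreset (R : realType) (d k : nat) (alpha t : R)
    (c : {fset 'cV[R]_d} -> {fset 'cV[R]_d}) : Prop :=
  [/\ 0 < alpha,
      forall V, (c V `<=` V)%fset,
      forall V, (#|` c V|)%:R <= t
    & forall (p : nat) (V : 'I_p -> {fset 'cV[R]_d}),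
        alpha^-1 * kdet_max k (\bigcup_(i <- enum 'I_p) V i)%fset
          <= kdet_max k (\bigcup_(i <- enum 'I_p) c (V i))%fset].

(* Main.v *)
(** Write k = m + K with m = o(k), and let (a_s), s in T, be more than K k^beta
    nearly orthogonal vectors of R^m. For f : [K] -> T let H_f be the graph of
    y |-> (<a_(f 1), y>, .., <a_(f K), y>) in R^m x R^K, and let the i-th input
    set lie in H_f + R e_i: it consists of the lifts of the a_s to H_f with the
    i-th coordinate of R^K replaced by 0. This set does not depend on f i, while
    relative to H_f the point indexed by s has e_i-component -<a_(f i), a_s>,
    which is large only for s = f i. Since a core-set keeps at most k^beta of
    the points, averaging over f yields an f for which, for every i, the point
    indexed by f i is discarded. A basis of H_f and the discarded points have a
    large determinant; without the latter, every determinant is small.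

    The a_s are the indicator vectors of the graphs of polynomials of bounded
    degree over a field with q elements: m = q^2, the squared norms are q, and
    the inner products are bounded by the degree. *)

Require Import Defs.
From mathcomp Require Import all_boot all_order all_algebra all_fingroup finmap.
From mathcomp Require Import all_classical all_reals all_analysis finfield zify lra.
Import Order.TTheory GRing.Theory Num.Theory.
Import numFieldNormedType.Exports.
Local Open Scope classical_set_scope.
Local Open Scope ring_scope.

(** * Determinant bounds and the objective on zero-padded columns *)

(** Expanding the product gives one term for every map of the indices; the Leibniz formula involves
    only the injective ones. *)
Lemma norm_det_le_row_sums (R : numDomainType) (n : nat) (A : 'M[R]_n) :
  `|\det A| <= \prod_i \sum_j `|A i j|.
Proof.
rewrite bigA_distr_bigA /= (bigID (fun f : {ffun 'I_n -> 'I_n} => injectiveb f)) /=.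
apply: le_trans (_ : \sum_(s : 'S_n) \prod_i `|A i (s i)| <= _).
  apply: (le_trans (ler_norm_sum _ _ _)); apply: ler_sum => s _.
  by rewrite normrM normrX normrN1 expr1n mul1r normr_prod.
rewrite [X in _ <= X + _](reindex (@pval _)) /=; last first.
  pose in_Sn := insubd (1%g : 'S_n).
  by exists in_Sn => /= f Uf; first apply: val_inj; apply: insubdK.
rewrite [X in _ <= X + _](eq_bigl xpredT) => [|s]; last by rewrite (valP s).
rewrite [X in _ <= X + _](eq_bigr (fun s : 'S_n => \prod_i `|A i (s i)|)) => [|s _].
  by rewrite lerDl; apply: sumr_ge0 => f _; apply: prodr_ge0.
by apply: eq_bigr => i _; rewrite pvalE.
Qed.

(** Any other principal submatrix of size [k] contains a zero row, so a single minor survives. *)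
Lemma kdet_block0 (R : comPzRingType) (k e : nat) (A : 'M[R]_k) :
  kdet k (block_mx A 0 0 (0 : 'M[R]_e)) = \det A.
Proof.
pose S0 : {set 'I_(k + e)} := (lshift e @: 'I_k)%SET.
have cS0 : #|S0| = k by rewrite card_imset ?card_ord //; exact: lshift_inj.
rewrite /kdet (bigD1 S0) ?cS0 //= big1 ?addr0.
  have hS0 (i : 'I_#|S0|) : exists j, enum_val i == lshift e j.
    by have /imsetP[j _ ->] := enum_valP i; exists j.
  pose f (i : 'I_k) : 'I_k := xchoose (hS0 (cast_ord (esym cS0) i)).
  have fE i : enum_val (cast_ord (esym cS0) i) = lshift e (f i).
    exact/eqP/(xchooseP (hS0 _)).
  have finj : injective f.
    move=> i j /(congr1 (lshift e)); rewrite -!fE => /enum_val_inj.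
    exact: cast_ord_inj.
  pose s := perm finj.
  (* Permuting rows and columns alike cancels the signs, so the order in which [enum_val] lists [S0]
     is irrelevant. *)
  have -> : \det A = \det (row_perm s (col_perm s A)).
    rewrite row_permE col_permE !det_mulmx !det_perm odd_permV mulrCA.
    by rewrite -signr_addb addbb mulr1.
  suff H : forall n (h : k = n) (B : 'M[R]_n),
      (forall i j, B (cast_ord h i) (cast_ord h j) = A (f i) (f j)) ->
      \det B = \det (row_perm s (col_perm s A)).
    by apply: (H _ (esym cS0)) => i j; rewrite mxE !fE block_mxEul.
  move=> n h; case: _ / h => B HB; congr (\det _); apply/matrixP => i j.
  by rewrite !mxE !permE -HB !cast_ord_id.
move=> S /andP[/eqP cS neS].
have [i iS iS0] : exists2 i, i \in S & i \notin S0.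
  apply/subsetPn; apply: contra neS => sub.
  by rewrite eqEcard sub cS cS0 leqnn.
have [j iE] : exists j, i = rshift k j.
  case: (split_ordP i) iS0 => j ->; last by exists j.
  by case/imsetP; exists j.
have row0 l : block_mx A 0 0 (0 : 'M[R]_e) i l = 0.
  by rewrite iE; case: (split_ordP l) => l' ->; rewrite ?block_mxEdl ?block_mxEdr mxE.
rewrite (expand_det_row _ (enum_rank_in iS i)) big1 // => l _.
by rewrite mxE enum_rankK_in // row0 mul0r.
Qed.

Lemma kdet_max_ge (R : realType) (d k : nat) (V S : {fset 'cV[R]_d}) :
  (S `<=` V)%fset -> #|` S| = k -> kdet k (scatter S) <= kdet_max k V.
Proof.
move=> SV /eqP cS.
by apply: (Order.TotalTheory.le_bigmax_seq _ S) cS; rewrite fpowersetE.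
Qed.

Lemma kdet_max_le (R : realType) (d k : nat) (V : {fset 'cV[R]_d}) (b : R) :
  0 <= b ->
  (forall S, (S `<=` V)%fset -> #|` S| = k -> kdet k (scatter S) <= b) ->
  kdet_max k V <= b.
Proof.
move=> b0 H; rewrite /kdet_max big_seq_cond.
apply: (big_ind (fun x => x <= b)) => // [x y xb yb|S].
  by rewrite ge_max xb.
by case/andP; rewrite fpowersetE => SV /eqP; exact: H.
Qed.

Lemma kdet_max_sub (R : realType) (d k : nat) (V W : {fset 'cV[R]_d}) :
  (V `<=` W)%fset -> kdet_max k V <= kdet_max k W.
Proof.
move=> VW; apply: kdet_max_le; first exact: bigmax_ge_id.
by move=> S SV cS; apply: kdet_max_ge => //; exact: fsubset_trans VW.
Qed.

Lemma scatter_columns (R : realType) (d n : nat) (X : 'M[R]_(d, n)) :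
  injective (fun j => col j X) ->
  scatter [fset col j X | j in 'I_n]%fset = X *m X^T.
Proof.
move=> Xinj; rewrite /scatter big_imfset /=; last exact: in2W Xinj.
rewrite big_enum_cond /=; apply/matrixP => i l.
rewrite summxE mxE; apply: eq_big => // j _.
by rewrite !mxE big_ord1 !mxE.
Qed.

Lemma fset_columns (R : realType) (d n : nat) (S : {fset 'cV[R]_d}) :
  #|` S| = n -> exists X : 'M[R]_(d, n),
    scatter S = X *m X^T /\ forall j, col j X \in S.
Proof.
move=> cS; pose X : 'M[R]_(d, n) := \matrix_(i, j) (nth 0 (enum_fset S) j) i 0.
have colX j : col j X = nth 0 (enum_fset S) j.
  by apply/matrixP => i l; rewrite !mxE ord1.
exists X; split; last by move=> j; rewrite colX mem_nth // -[size _]/(#|` S|) cS.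
rewrite /scatter (big_nth 0) -[size _]/(#|` S|) cS big_mkord.
apply/matrixP => i l; rewrite summxE mxE; apply: eq_bigr => j _.
by rewrite -colX !mxE big_ord1 !mxE.
Qed.

Lemma kdet_gram_pad (R : realType) (k e : nat) (X : 'M[R]_k) :
  kdet k (col_mx X (0 : 'M[R]_(e, k)) *m (col_mx X 0)^T) = \det X ^+ 2.
Proof.
rewrite tr_col_mx mul_col_row trmx0 !mulmx0 !mul0mx kdet_block0.
by rewrite det_mulmx det_tr.
Qed.

(** A nonzero determinant forces distinct columns, which thus form a set of exactly [k] vectors. *)
Lemma kdet_max_ge_det (R : realType) (k e : nat) (X : 'M[R]_k)
    (V : {fset 'cV[R]_(k + e)}) :
  \det X != 0 -> (forall j, col_mx (col j X) 0 \in V) ->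
  \det X ^+ 2 <= kdet_max k V.
Proof.
move=> dX HV; pose Y : 'M[R]_(k + e, k) := col_mx X 0.
have colY j : col j Y = col_mx (col j X) 0 by rewrite col_col_mx linear0.
have Yinj : injective (fun j => col j Y).
  move=> i j /eqP; rewrite !colY; apply: contraTeq => ij.
  apply: contra dX => /eqP/eq_col_mx[+ _].
  move=> /matrixP XE; rewrite -det_tr; apply/eqP/(determinant_alternate ij) => l.
  by have := XE l 0; rewrite !mxE.
rewrite -(kdet_gram_pad R k e) -/Y -scatter_columns //; apply: kdet_max_ge.
  by apply/fsubsetP => v /imfsetP[j _ ->] /=; rewrite colY.
by rewrite card_imfset //= size_enum_ord.
Qed.

(** * Averaging over choice functions, and determinants with sparse rows *)

(** For uniformly random [f], the value [f i] is independent of [B f i], so it falls there with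
    probability at most [n / #|T|]; a union bound over [I] concludes. *)
Lemma ffun_avoiding (I T : finType) (n : nat)
    (B : {ffun I -> T} -> I -> {set T}) :
  (forall (i : I) (f g : {ffun I -> T}),
     (forall j, j != i -> f j = g j) -> B f i = B g i) ->
  (forall (f : {ffun I -> T}) i, #|B f i| <= n)%N -> (#|I| * n < #|T|)%N ->
  exists f : {ffun I -> T}, forall i, f i \notin B f i.
Proof.
move=> Bloc Bcard nT.
have [t0 _|/eq_card0 T0] := pickP T; last by rewrite T0 in nT.
pose upd i (p : {ffun I -> T} * T) : {ffun I -> T} :=
  [ffun j => if j == i then p.2 else p.1 j].
have count i : (#|T| * \sum_(f : {ffun I -> T}) (f i \in B f i) <= #|{ffun I -> T}| * n)%N.
  have -> : (#|T| * \sum_(f : {ffun I -> T}) (f i \in B f i) =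
             \sum_(f : {ffun I -> T}) \sum_t (t \in B f i))%N.
    rewrite big_distrr /= [RHS]pair_bigA /=.
    under eq_bigr do rewrite -sum_nat_const.
    rewrite pair_bigA /=.
    (* Exchanging [t] and [f i] preserves [B f i]. *)
    pose h (p : {ffun I -> T} * T) := (upd i p, p.1 i).
    have hK : involutive h.
      case=> f t; rewrite /h /upd /= ffunE eqxx; congr (_, _).
      by apply/ffunP => j; rewrite !ffunE; case: eqP => // ->.
    rewrite (reindex_inj (inv_inj hK)); apply: eq_bigr => -[f t] _ /=.
    rewrite ffunE eqxx (Bloc i _ f) // => j /negbTE ji.
    by rewrite ffunE ji.
  rewrite -sum_nat_const; apply: leq_sum => f _.
  by apply: leq_trans (Bcard f i); rewrite -sum1_card [leqRHS]big_mkcond.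
case: (pickP (fun f : {ffun I -> T} => [forall i, f i \notin B f i])).
  by move=> f /forallP; exists f.
move=> nof.
(* If no [f] works, each [f] is counted for at least one [i]. *)
have cover : (#|{ffun I -> T}| <= \sum_i \sum_(f : {ffun I -> T}) (f i \in B f i))%N.
  rewrite exchange_big -sum1_card; apply: leq_sum => f _.
  have /forallPn[i] := negbT (nof f); rewrite negbK => fi.
  by rewrite (bigD1 i) //= fi.
have F0 : (0 < #|{ffun I -> T}|)%N by apply/card_gt0P; exists [ffun=> t0].
have : (#|T| * #|{ffun I -> T}| <= #|I| * n * #|{ffun I -> T}|)%N.
  rewrite (leq_trans (leq_mul (leqnn _) cover)) // big_distrr /=.
  rewrite -mulnA [(n * _)%N]mulnC -sum_nat_const; apply: leq_sum => i _.
  exact: count.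
by rewrite leq_pmul2r // leqNgt nT.
Qed.

(** The lower rows have disjoint supports, of total size at most [m + K]. Bounding each support size
    [n] by [2 ^ n] turns the product of their row sums into [r ^ K * 2 ^ (m + K)]. *)
Lemma norm_det_sparse_le (R : numDomainType) (m K : nat) (Y : 'M[R]_(m + K)) (r : R) :
  0 <= r -> (forall l x, `|Y (lshift K l) x| <= 1) ->
  (forall j x, `|Y (rshift m j) x| <= r) ->
  (forall x i j, Y (rshift m i) x != 0 -> Y (rshift m j) x != 0 -> i = j) ->
  `|\det Y| <= (m + K)%:R ^+ m * (r ^+ K * 2 ^+ (m + K)).
Proof.
move=> r0 Y1 Yr Ysparse.
apply: le_trans (norm_det_le_row_sums _ _ _) _; rewrite big_split_ord /=.
pose supp j := #|[pred x | Y (rshift m j) x != 0]|.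
have supp_le : (\sum_j supp j <= m + K)%N.
  rewrite /supp; under eq_bigr do rewrite -sum1_card big_mkcond /=.
  rewrite exchange_big /= -[leqRHS]card_ord -sum1_card; apply: leq_sum => x _.
  rewrite -big_mkcond /= sum1_card; apply/card_le1_eqP => i j.
  by move=> Yi Yj; exact: (Ysparse x _ _ Yj Yi).
apply: ler_pM; try by apply: prodr_ge0 => i _; apply: sumr_ge0.
  rewrite -[X in _ ^+ X]card_ord -prodr_const.
  apply: ler_prod => l _; rewrite sumr_ge0 //=.
  apply: le_trans (_ : \sum_(x < m + K) 1 <= _); first exact: ler_sum.
  by rewrite sumr_const card_ord.
apply: le_trans (_ : \prod_(j < K) (r * 2 ^+ supp j) <= _).
  apply: ler_prod => j _; rewrite sumr_ge0 //=.
  apply: le_trans (_ : r * (supp j)%:R <= _).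
    rewrite mulr_natr -sumr_const [leRHS]big_mkcond /=; apply: ler_sum => x _.
    by rewrite inE; case: eqP => [->|_]; rewrite ?normr0.
  by rewrite ler_wpM2l // -natrX ler_nat ltnW // ltn_expl.
rewrite big_split /= prodr_const card_ord -expr_sum.
by rewrite ler_wpM2l ?exprn_ge0 // ler_weXn2l ?ler1n.
Qed.

Lemma col_mulmx (R : pzRingType) (m n p : nat) (A : 'M[R]_(m, n)) (B : 'M[R]_(n, p)) j :
  col j (A *m B) = A *m col j B.
Proof. by rewrite !colE mulmxA. Qed.

(** * The hard instance, before and after passing to the core-set *)

Section Construction.
Context (R : realType) (m K e : nat) (T : finType) (a : T -> 'cV[R]_m).
Implicit Types (f : {ffun 'I_K -> T}) (i j : 'I_K) (l : 'I_m) (s : T).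

Definition chosen_rows f : 'M[R]_(K, m) := \matrix_(j, l) a (f j) l 0.

Definition base_vec f l : 'cV[R]_(m + K) :=
  col_mx (delta_mx l 0) (col l (chosen_rows f)).

Definition code_vec f i s : 'cV[R]_(m + K) :=
  col_mx (a s) (\col_j if j == i then 0 else (chosen_rows f *m a s) j 0).

(** The [e] trailing zeros embed the instance into any dimension [d >= k]. *)
Definition base_set f : {fset 'cV[R]_(m + K + e)} :=
  [fset col_mx (base_vec f l) 0 | l in 'I_m]%fset.

Definition code_set f i : {fset 'cV[R]_(m + K + e)} :=
  [fset col_mx (code_vec f i s) 0 | s in T]%fset.

(* In the coordinates [z_j - <a (f j), y>] the graph H_f becomes R^m x 0. *)
Definition shear f : 'M[R]_(m + K) := block_mx 1%:M 0 (- chosen_rows f) 1%:M.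

Lemma det_shear f : \det (shear f) = 1.
Proof. by rewrite det_lblock !det1 mulr1. Qed.

Lemma shear_base_vec f l : shear f *m base_vec f l = col_mx (delta_mx l 0) 0.
Proof.
rewrite mul_block_col !mul1mx mul0mx addr0; congr col_mx.
by rewrite colE mulNmx addNr.
Qed.

(** Away from coordinate [i] the point agrees with [H_f], so the shear leaves at most one nonzero
    lower entry, as the sparse determinant bound requires. *)
Lemma shear_code_vec f i s :
  shear f *m code_vec f i s =
  col_mx (a s) (\col_j if j == i then - (chosen_rows f *m a s) i 0 else 0).
Proof.
rewrite mul_block_col !mul1mx mul0mx addr0; congr col_mx.
apply/matrixP => j z; rewrite mulNmx !ord1 mxE [in LHS]mxE.
rewrite [X in _ + X]mxE [RHS]mxE.
by case: eqP => [->|_]; rewrite ?addr0 // addNr.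
Qed.

Lemma chosen_rows_mul f i s :
  (chosen_rows f *m a s) i 0 = \sum_l a (f i) l 0 * a s l 0.
Proof. by rewrite mxE; apply: eq_bigr => l _; rewrite mxE. Qed.

Lemma code_vec_local i f (g : {ffun 'I_K -> T}) s :
  (forall j, j != i -> f j = g j) -> code_vec f i s = code_vec g i s.
Proof.
move=> fg; congr col_mx; apply/matrixP => j z; rewrite !mxE.
case: eqP => // /eqP ji.
by apply: eq_bigr => l _; rewrite !mxE fg.
Qed.

Lemma code_set_local i f (g : {ffun 'I_K -> T}) : (forall j, j != i -> f j = g j) ->
  code_set f i = code_set g i.
Proof.
move=> fg; have vE s := code_vec_local i f g s fg.
by apply/fsetP => v; apply/imfsetP/imfsetP => -[s sT ->]; exists s; rewrite ?vE.
Qed.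

(* Index 0 carries the basis of the graph H_f, index i + 1 the i-th code set. *)
Definition hard_instance f (z : 'I_K.+1) : {fset 'cV[R]_(m + K + e)} :=
  if unlift ord0 z is Some i then code_set f i else base_set f.

Lemma kdet_max_hard_instance_ge (q : R) f : 0 < q ->
  (forall s, \sum_l a s l 0 * a s l 0 = q) ->
  (q ^+ K) ^+ 2 <=
  kdet_max (m + K) (\bigcup_(z <- enum 'I_K.+1) hard_instance f z)%fset.
Proof.
move=> q0 aq.
pose A : 'M[R]_(m, K) := \matrix_(l, i) a (f i) l 0.
pose B : 'M[R]_K := \matrix_(j, i) if j == i then 0 else (chosen_rows f *m A) j i.
pose X : 'M[R]_(m + K) := block_mx 1%:M A (chosen_rows f) B.
have colA i : col i A = a (f i) by apply/matrixP => l z; rewrite !mxE !ord1.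
(* The columns of [X] are the basis of [H_f] and the points indexed by [f i]; the shear makes [X]
   block upper triangular with lower right block [- q] times the identity. *)
have detX : \det X = (- q) ^+ K.
  rewrite -[LHS]mul1r -(det_shear f) -det_mulmx mulmx_block.
  rewrite !mul1mx !mul0mx !mulmx1 !addr0 addNr det_ublock det1 mul1r.
  suff -> : - chosen_rows f *m A + B = (- q)%:M by rewrite det_scalar.
  apply/matrixP => j i; rewrite mulNmx mxE [X in X + _]mxE [X in _ + X]mxE.
  rewrite [RHS]mxE; case: eqP => [->|_]; last by rewrite addNr.
  rewrite addr0 mulr1n; congr (- _); rewrite -[RHS](aq (f i)) -chosen_rows_mul.
  by rewrite -colA -col_mulmx [RHS]mxE.
have -> : (q ^+ K) ^+ 2 = \det X ^+ 2.
  by rewrite detX -!exprM mulnC !exprM sqrrN.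
apply: kdet_max_ge_det => [|x].
  by rewrite detX expf_neq0 // oppr_eq0 gt_eqF.
apply/bigfcupP; case: (split_ordP x) => [l|i] ->.
  exists ord0; first by rewrite mem_enum.
  rewrite /hard_instance unlift_none; apply/imfsetP; exists l => //=.
  congr col_mx; rewrite /X block_mxEh colKl col_col_mx; congr col_mx.
  by apply/matrixP => y z; rewrite !mxE !ord1 andbT.
exists (lift ord0 i); first by rewrite mem_enum.
rewrite /hard_instance liftK; apply/imfsetP; exists (f i) => //=.
congr col_mx; rewrite /X block_mxEh colKr col_col_mx colA; congr col_mx.
apply/matrixP => j z; rewrite !mxE; case: eqP => // _.
by apply: eq_bigr => l _; rewrite !mxE.
Qed.

(** With the points indexed by [f i] absent, every nonzero lower entry after shearing is an inner
    product of two distinct code vectors, hence at most [r] in absolute value. *)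
Lemma kdet_max_unchosen_le (r : R) f (W : {fset 'cV[R]_(m + K + e)}) :
  0 <= r -> (forall s l, `|a s l 0| <= 1) ->
  (forall s t, s != t -> `|\sum_l a s l 0 * a t l 0| <= r) ->
  (forall v, v \in W -> (exists l, v = col_mx (base_vec f l) 0) \/
     exists i s, f i != s /\ v = col_mx (code_vec f i s) 0) ->
  kdet_max (m + K) W <= ((m + K)%:R ^+ m * (r ^+ K * 2 ^+ (m + K))) ^+ 2.
Proof.
move=> r0 a1 ar HW; apply: kdet_max_le => [|S SW cS]; first exact: sqr_ge0.
have [X [-> XS]] := fset_columns _ _ _ _ cS.
have XW x : col x X \in W by apply: (fsubsetP SW).
have X0 : X = col_mx (usubmx X) 0.
  rewrite -[LHS]vsubmxK; congr col_mx; apply/matrixP => i x.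
  have -> : dsubmx X i x = dsubmx (col x X) i 0 by rewrite !mxE.
  by case: (HW _ (XW x)) => [[l]|[j [s [_]]]] ->; rewrite col_mxKd !mxE.
rewrite X0 kdet_gram_pad -[\det _]mul1r -{1}(det_shear f) -det_mulmx.
set Y := shear f *m usubmx X.
have YE (y : 'I_(m + K)) x : Y y x = (shear f *m usubmx (col x X)) y 0.
  have -> : usubmx (col x X) = col x (usubmx X) by apply/matrixP => l z; rewrite !mxE.
  by rewrite -col_mulmx -/Y [RHS]mxE; reflexivity.
rewrite -real_normK ?num_real // ler_sqr ?nnegrE //; last first.
  by rewrite !mulr_ge0 ?exprn_ge0.
apply: norm_det_sparse_le => //.
- move=> l x; rewrite YE.
  case: (HW _ (XW x)) => [[y]|[i [s [_]]]] ->; rewrite col_mxKu.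
    by rewrite shear_base_vec col_mxEu mxE; case: eqP; rewrite ?normr1 ?normr0.
  by rewrite shear_code_vec col_mxEu.
- move=> j x; rewrite YE.
  case: (HW _ (XW x)) => [[y]|[i [s [fs]]]] ->; rewrite col_mxKu.
    by rewrite shear_base_vec col_mxEd mxE normr0.
  rewrite shear_code_vec col_mxEd mxE; case: eqP => _; last by rewrite normr0.
  by rewrite normrN chosen_rows_mul ar.
- move=> x i j; rewrite !YE.
  case: (HW _ (XW x)) => [[y]|[z [s [fs]]]] ->; rewrite col_mxKu.
    by rewrite shear_base_vec col_mxEd mxE eqxx.
  rewrite shear_code_vec !col_mxEd !mxE.
  by case: (i =P z) => [->|_]; case: (j =P z) => [->|_]; rewrite ?eqxx.
Qed.

Lemma coreset_approx_ge (alpha tmax q r : R) (n : nat)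
    (c : {fset 'cV[R]_(m + K + e)} -> {fset 'cV[R]_(m + K + e)}) :
  composable_coreset (m + K) alpha tmax c ->
  (forall V, #|` c V| <= n)%N -> (K * n < #|T|)%N ->
  (forall s l, `|a s l 0| <= 1) ->
  (forall s, \sum_l a s l 0 * a s l 0 = q) ->
  (forall s t, s != t -> `|\sum_l a s l 0 * a t l 0| <= r) ->
  0 <= r -> r < q ->
  (q ^+ K) ^+ 2 <=
  alpha * ((m + K)%:R ^+ m * (r ^+ K * 2 ^+ (m + K))) ^+ 2.
Proof.
move=> [alpha0 csub _ capx] cn nT a1 aq ar r0 rq.
have q0 := le_lt_trans r0 rq.
(* The indices kept by the core-set; they depend on [f] only away from [i], because the [i]-th code
   set does. *)
pose B f i : {set T} :=
  finset (fun s => col_mx (code_vec f i s) 0 \in c (code_set f i)).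
(* If [a s = a t] with [s != t], their inner product would be [q > r]. *)
have vinj f i : injective (fun s => col_mx (code_vec f i s) (0 : 'cV[R]_e)).
  move=> s t /eq_col_mx[/eq_col_mx[ast _] _]; apply/eqP; apply: contraT => st.
  by have := ar _ _ st; rewrite -ast aq leNgt gtr0_norm ?rq.
have [f fB] : exists f, forall i, f i \notin B f i.
  apply: (ffun_avoiding _ _ n) => [i f g fg|f i|]; last by rewrite card_ord.
    by apply/setP => s; rewrite !inE (code_set_local i f g fg) (code_vec_local i f g s fg).
  apply: leq_trans (cn (code_set f i)).
  rewrite cardE -(size_map (fun s => col_mx (code_vec f i s) (0 : 'cV[R]_e))).
  apply: uniq_leq_size; first by rewrite (map_inj_uniq (vinj f i)) enum_uniq.
  by move=> v /mapP[s]; rewrite mem_enum inE => ? ->.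
have := capx _ (hard_instance f).
rewrite ler_pdivrMl // => /(le_trans (kdet_max_hard_instance_ge _ f q0 aq)) /le_trans.
apply; rewrite ler_pM2l //; apply: (kdet_max_unchosen_le _ f) => // v.
case/bigfcupP => z _; rewrite /hard_instance; case: (unliftP ord0 z) => [i|] _ vc.
  right; exists i.
  have /imfsetP[s _ vE] := fsubsetP (csub _) _ vc; exists s; split => //.
  by apply: contraNneq (fB i) => ->; rewrite inE -vE.
by left; have /imfsetP[l _ vE] := fsubsetP (csub _) _ vc; exists l.
Qed.

End Construction.

(** * Nearly orthogonal vectors from polynomials over a finite field *)

Lemma card_horner_eq_lt (F : finFieldType) (s : nat) (u v : 'rV[F]_s) :
  u != v -> (#|[set x | (rVpoly u).[x] == (rVpoly v).[x]]%SET| < s)%N.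
Proof.
move=> uv; have p0 : rVpoly u - rVpoly v != 0.
  rewrite subr_eq0; apply: contraNneq uv => /(congr1 (@poly_rV _ s)).
  by rewrite !rVpolyK => ->.
rewrite cardE; apply: leq_trans (_ : size (rVpoly u - rVpoly v)%R <= s)%N.
  apply: max_poly_roots => //; last exact: enum_uniq.
  apply/allP => x; rewrite mem_enum inE => /eqP xE.
  by rewrite /root hornerD hornerN xE subrr.
by rewrite (leq_trans (size_polyD _ _)) // size_polyN geq_max !size_poly.
Qed.

Definition graph_vec (R : realType) (F : finFieldType) (s : nat) (u : 'rV[F]_s) :
    'cV[R]_#|{: F * F}| :=
  \col_l ((rVpoly u).[(enum_val l).1] == (enum_val l).2)%:R.

Lemma graph_vec_dot (R : realType) (F : finFieldType) (s : nat) (u v : 'rV[F]_s) :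
  \sum_l graph_vec R F s u l 0 * graph_vec R F s v l 0 =
  #|[set x | (rVpoly u).[x] == (rVpoly v).[x]]%SET|%:R.
Proof.
under eq_bigr do rewrite !mxE -natrM mulnb.
rewrite -natr_sum; congr (_%:R).
rewrite -(big_enum_val (fun p : F * F =>
  nat_of_bool (((rVpoly u).[p.1] == p.2) && ((rVpoly v).[p.1] == p.2)))) /=.
rewrite -(pair_bigA _ (fun x y =>
  nat_of_bool (((rVpoly u).[x] == y) && ((rVpoly v).[x] == y)))) /=.
rewrite -sum1_card [RHS]big_mkcond; apply: eq_bigr => x _.
(* For each [x], only the point of the graph of [u] above [x] can contribute. *)
rewrite inE (bigD1 (rVpoly u).[x]) //= eqxx /= big1 ?addn0 => [|y].
  by rewrite eq_sym; case: eqP.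
by rewrite eq_sym => /negbTE ->.
Qed.

Lemma coreset_approx_finfield (R : realType) (F : finFieldType)
    (s n k d : nat) (alpha tmax : R)
    (c : {fset 'cV[R]_d} -> {fset 'cV[R]_d}) :
  (#|F| ^ 2 <= k)%N -> (k <= d)%N -> (s < #|F|)%N ->
  composable_coreset k alpha tmax c -> (forall V, #|` c V| <= n)%N ->
  ((k - #|F| ^ 2) * n < #|F| ^ s)%N ->
  ((#|F| ^ (k - #|F| ^ 2)) ^ 2)%:R <=
  alpha * ((k ^ (#|F| ^ 2) * (s ^ (k - #|F| ^ 2) * 2 ^ k)) ^ 2)%:R.
Proof.
have -> : (#|F| ^ 2 = #|{: F * F}|)%N by rewrite card_prod.
(* Rewriting [k] as [m + K] and [d] as [m + K + e] gives the types of the construction. *)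
set m := #|{: F * F}| => mk kd sF cc cn.
have dE := subnKC kd; move: (d - k)%N dE => e dE; subst d.
have kE := subnKC mk; move: (k - m)%N kE => K kE KT; subst k.
rewrite natrX natrX natrX !natrM !natrX.
apply: (coreset_approx_ge _ _ _ _ _ (graph_vec R F s) _ _ _ _ _ _ cc cn).
- by rewrite card_mx mul1n.
- by move=> u l; rewrite mxE normr_nat lern1 leq_b1.
- move=> u; rewrite graph_vec_dot; congr (_%:R).
  by apply: eq_card => x; rewrite !inE eqxx.
- by move=> u v uv; rewrite graph_vec_dot normr_nat ler_nat ltnW // card_horner_eq_lt.
- exact: ler0n.
- by rewrite ltr_nat.
Qed.

(** A single input with positive objective, the first [k] unit vectors, cannot gain by passing to a
    subset. *)
Lemma coreset_approx_ge1 (R : realType) (k d : nat) (alpha tmax : R)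
    (c : {fset 'cV[R]_d} -> {fset 'cV[R]_d}) :
  (k <= d)%N -> composable_coreset k alpha tmax c -> 1 <= alpha.
Proof.
move=> kd [alpha0 csub _ capx].
have dE := subnKC kd; move: (d - k)%N dE => e dE; subst d.
pose V : {fset 'cV[R]_(k + e)} := [fset col_mx (col j 1%:M) 0 | j in 'I_k]%fset.
have fV : 0 < kdet_max k V.
  apply: lt_le_trans (kdet_max_ge_det R k e 1%:M V _ _).
  - by rewrite det1 expr1n.
  - by rewrite det1 oner_neq0.
  - by move=> j; apply/imfsetP; exists j.
have := capx 1%N (fun=> V).
have big1V (W : {fset 'cV[R]_(k + e)}) : (\bigcup_(i <- enum 'I_1) W)%fset = W.
  by rewrite big_enum /= big_ord1.
rewrite !big1V => /le_trans/(_ (kdet_max_sub _ _ _ _ _ (csub V))).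
by rewrite ler_pdivrMl // ler_pMl.
Qed.

(** * Numerical estimates and the choice of parameters *)

Lemma sqr_succ_le_exp2 (w : nat) : (w.+1 ^ 2 <= 4 * 2 ^ w)%N.
Proof.
elim: w => // -[|[|w]] // IH.
apply: leq_trans (_ : 2 * w.+3 ^ 2 <= _)%N; first by nia.
by rewrite [(2 ^ w.+3)%N]expnS mulnCA leq_mul2l.
Qed.

Lemma linear_le_exp2 (w : nat) : (4 * w <= 2 ^ w + 20)%N.
Proof.
elim: w => // -[|[|w]] // IH.
have : (4 <= 2 ^ w.+2)%N by rewrite -[4%N]/(2 ^ 2)%N leq_exp2l.
by rewrite [(2 ^ w.+3)%N]expnS; move: (2 ^ w.+2)%N IH => p; lia.
Qed.

(* Here q = 2 ^ r, and w is a logarithm of l: then q ^ 2 <= 2 ^ (l - w) is o(k),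
   while ln q is still asymptotic to (ln k) / 2. *)
Section Exponents.
Context (k l w r s B : nat).
Context (wl : (2 ^ w <= l < 2 ^ w.+1)%N) (lk : (2 ^ l <= k < 2 ^ l.+1)%N).
Context (rE : r = (l - w)./2) (sE : s = (8 * B.+1)%N).
Context (large : (w + (15 + 2 * s) < l)%N).

Lemma double_r_bounds : (l - w - 1 <= 2 * r <= l - w)%N.
Proof. by rewrite rE; lia. Qed.

Lemma field_sqr_exp_le : ((2 ^ r) ^ 2 * 2 ^ w <= 2 ^ l)%N.
Proof.
rewrite -expnM -expnD leq_exp2l //.
by have := double_r_bounds; lia.
Qed.

Lemma field_sqr_le : ((2 ^ r) ^ 2 <= k)%N.
Proof.
have /andP[lk1 _] := lk; apply: leq_trans lk1; apply: leq_trans field_sqr_exp_le.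
by rewrite leq_pmulr ?expn_gt0.
Qed.

Lemma degree_lt_field : (s < 2 ^ r)%N.
Proof.
apply: leq_trans (ltn_expl s (isT : 1 < 2)%N) _; rewrite leq_exp2l //.
by have := double_r_bounds; lia.
Qed.

(** The left side is below [2 ^ (l.+1 * B.+1)], so [s = 8 * B.+1] reduces the claim to
    [l.+1 <= 8 * r]. This holds since [8 * r] is at least [4 * (l - w - 1)] and
    [4 * w <= l + 20]. *)
Lemma code_large : ((k - (2 ^ r) ^ 2) * k ^ B < (2 ^ r) ^ s)%N.
Proof.
have /andP[_ kl] := lk.
apply: leq_ltn_trans (_ : k ^ B.+1 < _)%N.
  by rewrite [(k ^ B.+1)%N]expnS leq_mul2r leq_subr orbT.
apply: leq_trans (_ : (2 ^ l.+1) ^ B.+1 <= _)%N; first by rewrite ltn_exp2r.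
rewrite sE expnM leq_exp2r // -expnM leq_exp2l //.
have /andP[r1 _] := double_r_bounds; have /andP[w1 _] := wl.
have := linear_le_exp2 w; move: w1; move: (2 ^ w)%N => p; clear -r1 large; lia.
Qed.

(** Everything is compared through exponents of [2]: the [2 * s] pays for the squared power of [s],
    and [15] leaves room for the other losses, each linear in [k]. *)
Lemma code_gain :
  (2 ^ (k * (l - w - (15 + 2 * s))) *
   (k ^ ((2 ^ r) ^ 2) * (s ^ (k - (2 ^ r) ^ 2) * 2 ^ k)) ^ 2 <=
   ((2 ^ r) ^ (k - (2 ^ r) ^ 2)) ^ 2)%N.
Proof.
have mk := field_sqr_le; have mw := field_sqr_exp_le.
have /andP[r1 _] := double_r_bounds.
have /andP[_ w2] := wl; have /andP[k1 k2] := lk.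
set m := ((2 ^ r) ^ 2)%N in mk mw *.
have s2 : (s <= 2 ^ s)%N by apply/ltnW/ltn_expl.
apply: leq_trans (_ : 2 ^ (k * (l - w - (15 + 2 * s))) *
  ((2 ^ l.+1) ^ m * ((2 ^ s) ^ k * 2 ^ k)) ^ 2 <= _)%N.
  have expW x y n : (x <= y)%N -> (x ^ n <= y ^ n)%N.
    by case: n => // n xy; rewrite leq_exp2r.
  rewrite leq_mul2l expW ?orbT // leq_mul ?expW ?(ltnW k2) // leq_mul2r.
  rewrite (leq_trans (expW _ _ _ s2)) ?orbT // leq_pexp2l ?expn_gt0 //.
  exact: leq_subr.
rewrite -!expnM -!expnD -!expnM -expnD leq_exp2l //.
(* The factor [k ^ m] costs only a linear number of bits: [m] is at most [k / 2 ^ w], while [l.+1]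
   is at most [2 ^ w.+1]. *)
have ml : (m * l.+1 <= 2 * k)%N.
  apply: leq_trans (_ : m * 2 ^ w.+1 <= _)%N; first by rewrite leq_mul2l w2 orbT.
  by rewrite expnS mulnCA leq_mul2l (leq_trans mw).
clear -r1 large mk ml; nia.
Qed.

End Exponents.

(** * Asymptotics in [k] *)

Lemma trunc_log2_cvgny : trunc_log 2 n @[n --> \oo] --> \oo.
Proof.
apply/cvgnyPge => A; exists (2 ^ A)%N => // n /= An.
exact: trunc_log_max.
Qed.

(** Applies the construction over the field with [2 ^ r] elements and cancels the upper bound for
    the discarded instance. *)
Lemma coreset_approx_exp (R : realType) (B k d : nat) (alpha tmax : R)
    (c : {fset 'cV[R]_d} -> {fset 'cV[R]_d}) :
  let l := trunc_log 2 k in let w := trunc_log 2 l in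
  let C := (15 + 2 * (8 * B.+1))%N in
  (w + C < l)%N -> (k <= d)%N -> composable_coreset k alpha tmax c ->
  (forall V, #|` c V| <= k ^ B)%N -> (2 ^ (k * (l - w - C)))%:R <= alpha.
Proof.
move=> l w C large kd cc cB.
have l0 : (0 < l)%N by lia.
have k0 : (0 < k)%N by case: (k) @l @w l0 large {cc cB kd c} => //; rewrite trunc_log0.
have wl := trunc_log_bounds (isT : 1 < 2)%N l0.
have lk := trunc_log_bounds (isT : 1 < 2)%N k0.
pose r := ((l - w)./2)%N.
have r0 : (0 < r)%N by rewrite /r; lia.
have [F _ cF] := pPrimePowerField (isT : prime 2) r0.
pose s := (8 * B.+1)%N.
have sq_le := field_sqr_le k l w r s B wl lk erefl erefl large.
have s_lt := degree_lt_field k l w r s B wl lk erefl erefl large.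
have code := code_large k l w r s B wl lk erefl erefl large.
have gain := code_gain k l w r s B wl lk erefl erefl large.
rewrite -cF in sq_le s_lt code gain.
have [alpha0 _ _ _] := cc.
have := coreset_approx_finfield R F s (k ^ B) k d alpha tmax c sq_le kd s_lt cc cB code.
set X := (_ ^ 2)%N in gain *; set Y := (_ ^ 2)%N in gain *.
have X0 : (0 < X)%N by rewrite !(expn_gt0, muln_gt0) k0.
rewrite -(ler_nat R) natrM in gain.
by move=> /(le_trans gain); rewrite ler_pM2r // ltr0n.
Qed.

Theorem theorem1p4 (R : realType) (beta : R) (hbeta : 1 <= beta) :
  exists delta : nat -> R,
    (delta k @[k --> \oo] --> (0 : R)) /\
    forall (k d : nat) (hkd : (k <= d)%N) (alpha : R)
           (c : {fset 'cV[R]_d} -> {fset 'cV[R]_d}),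
      composable_coreset k alpha (k%:R `^ beta) c ->
      (k%:R / beta) `^ (k%:R * (1 - delta k)) <= alpha.
Proof.
pose B := Num.bound beta.
have betaB : beta <= B%:R by apply/ltW/archi_boundP; exact: le_trans hbeta.
pose C := (15 + 2 * (8 * B.+1))%N.
pose wk k := trunc_log 2 (trunc_log 2 k).
(* [C.+2] comes from [w + C.+1 <= C.+2 * w.+1], and [4] from [w.+1 ^ 2 <= 4 * 2 ^ w]. *)
pose D : R := (4 * C.+2)%:R.
(* Truncating at 1 turns the claim into [1 <= alpha] when k is small. *)
pose delta k : R := Num.min 1 (D * harmonic (wk k)).
exists delta; split.
  have lim : D * harmonic (wk k) @[k --> \oo] --> (0 : R).
    rewrite -[X in _ --> X](mulr0 D); apply: cvgMl_tmp.
    apply: (cvg_comp _ _ _ (@cvg_harmonic R)).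
    exact: cvg_comp trunc_log2_cvgny trunc_log2_cvgny.
  apply: (squeeze_cvgr _ (cvg_cst 0) lim); near=> k.
  by rewrite /delta ge_min lexx orbT le_min ler01 mulr_ge0 ?ler0n ?invr_ge0.
move=> k d hkd alpha c cc; rewrite /delta.
have alpha1 := coreset_approx_ge1 _ _ _ _ _ _ hkd cc.
case: (leP 1 (D * harmonic (wk k))) => [_|D1]; first by rewrite subrr mulr0 powRr0.
set l := trunc_log 2 k; pose w := wk k.
(* The lost bits, measured against [l.+1], are at most the fraction [delta k]. *)
have w_l : (w + C.+1)%:R <= D * harmonic w * l.+1%:R.
  rewrite /harmonic /= mulrAC ler_pdivlMr ?ltr0n // -!natrM ler_nat.
  (* The successor covers [l = 0], where [w = 0] by convention. *)
  have wl : (2 ^ w <= l.+1)%N.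
    rewrite /w /wk -/l; case: (l) => [|n]; first by rewrite trunc_log0.
    by apply: leqW; rewrite trunc_logP.
  have w2 := sqr_succ_le_exp2 w.
  apply: leq_trans (_ : C.+2 * w.+1 ^ 2 <= _)%N.
    by rewrite -mulnn mulnA leq_mul2r /=; nia.
  by rewrite -mulnA mulnCA leq_mul2l (leq_trans w2) // leq_mul2l wl.
have large : (w + C < l)%N.
  have : (w + C.+1)%:R < l.+1%:R :> R.
    by apply: le_lt_trans w_l _; rewrite gtr_pMl ?ltr0n.
  by rewrite ltr_nat addnS.
have k0 : (0 < k)%N by case: (k) @l @w large {hkd cc D1 w_l} => //=; rewrite /wk !trunc_log0.
have cB V : (#|` c V| <= k ^ B)%N.
  have [_ _ /(_ V) cV _] := cc.
  rewrite -(ler_nat R) natrX -powR_mulrn // (le_trans cV) //.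
  by rewrite ler_powR // ler1n.
apply: le_trans (coreset_approx_exp R B k d alpha _ c large hkd cc cB).
have [_ k2] := andP (trunc_log_bounds (isT : 1 < 2)%N k0).
(* Since [beta >= 1], the base is at most [k < 2 ^ l.+1]; in base [2] the claim becomes
   [l.+1 * (1 - delta k) <= l - w - C], which is [w_l]. *)
apply: le_trans (_ : (2 ^ l.+1)%:R `^ (k%:R * (1 - D * harmonic w)) <= _).
  have kb : k%:R / beta <= (2 ^ l.+1)%:R.
    apply: le_trans (_ : k%:R <= _); last by rewrite ler_nat ltnW.
    by rewrite ler_pdivrMr ?(lt_le_trans _ hbeta) // ler_peMr.
  apply: ge0_ler_powR; rewrite ?nnegrE //.
    by rewrite mulr_ge0 // subr_ge0 ltW.
  by rewrite divr_ge0 // (le_trans _ hbeta).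
rewrite natrX -powR_mulrn // -powRrM natrX -powR_mulrn // ler_powR ?ler1n //.
rewrite natrM mulrCA ler_wpM2l // -subnDA natrB; last exact: ltnW.
rewrite -[trunc_log 2 (trunc_log 2 k)]/w -[trunc_log 2 k]/l -[(15 + _)%N]/C.
rewrite mulrBr mulr1.
have : l.+1%:R * (D * harmonic w) >= (w + C.+1)%:R by rewrite mulrC.
rewrite addnS -[l.+1%:R]natr1 -[(_ + _).+1%:R]natr1; lra.
Unshelve. all: by end_near.
Qed.
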